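(* Let $2\le a<b<c$ be pairwise relatively prime integers, $S=\langle ab,ac,bc\rangle$ and $S'=\langle ab,ac,bc,abc+1\rangle$, and suppose $abc+1\notin S$. Let $\gamma,\beta,\alpha$ be the unique integers with $1\le\gamma\le c-1$ and $\gamma ab\equiv 1\pmod c$; $1\le\beta\le b-1$ and $\beta ac\equiv 1\pmod b$; $1\le\alpha\le a-1$ and $\alpha bc\equiv 1\pmod a$. Then $F(S')=M$, where $$M:=\max\{(\gamma-1)ab+(b-1)ac-bc,\ (c-1)ab+(\beta-1)ac-bc,\ (c-1)ab+(b-1)ac+(\alpha-a-1)bc\}.$$
   Context: $\mathbb{N}=\{0,1,2,\dots\}$, and $\langle n_1,\dots,n_s\rangle$ denotes the set of $\mathbb{N}$-linear combinations of $n_1,\dots,n_s$. The Frobenius number $F(S)$ of a numerical semigroup $S$ is the largest element of $\mathbb{N}\setminus S$. *)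

(* Defs.v *)
From mathcomp Require Import all_boot all_order all_algebra.

Set Implicit Arguments.
Unset Strict Implicit.
Unset Printing Implicit Defensive.

Definition nspan (s : seq nat) (n : nat) : Prop :=
  exists k : nat -> nat, n = \sum_(i < size s) k i * nth 0 s i.

(* A relation: for a numerical semigroup [S <> nat] exactly one [f] satisfies
   it; for [S = nat], or [S] of infinite complement, none does. *)
Definition is_frobenius (S : nat -> Prop) (f : nat) : Prop :=
  ~ S f /\ (forall n : nat, ~ S n -> n <= f).

(* Main.v *)
Require Import Defs.
From mathcomp Require Import all_boot all_order all_algebra.
From mathcomp Require Import zify ring.
Import Order.TTheory GRing.Theory Num.Theory.
Local Open Scope ring_scope.

(** Because [a], [b], [c] are pairwise coprime, every integer [n] has a unique
    normal form
      [n = x * ab + y * ac + z * bc] with [0 <= x < c], [0 <= y < b], [z] in Z,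
    and [n] lies in [S = <ab, ac, bc>] exactly when [0 <= z]: carrying a
    multiple of [c] out of [x], or of [b] out of [y], adds copies of
    [abc = a * bc], which can only increase [z].

    The normal form of the new generator [w = abc + 1] is what the hypothesis
    on [w] determines.  By the Chinese remainder theorem
    [gamma * ab + beta * ac + alpha * bc] is [1] modulo [abc]; it lies strictly
    between [1] and [3abc], so it is [abc + 1] or [2abc + 1], and the first
    value would put [w] in [S] ([sum_inverses_eq]).  Hence
      [w = gamma * ab + beta * ac + (alpha - a) * bc].

    An element with negative [z] that lies in [S' = <ab, ac, bc, w>] uses [w]
    exactly once: all such elements are below [2abc], so two copies of [w] are
    already too large.  Subtracting one [w] lands in [S] precisely when
    [gamma <= x], [beta <= y] and [alpha - a <= z]; if one of the first two
    fails, the borrow costs at least [a] in the last coordinate, leaving a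
    negative one ([mem_extended]).

    So the gaps of [S'] are the [n] with [z < 0] and [x < gamma] or [y < beta]
    or [z < alpha - a].  As [n] increases with each coordinate, each of these
    three regions has its largest element at a corner, and the three corners are
    the three terms of the maximum. *)

Lemma nspan_nil (n : nat) : nspan [::] n <-> n = 0%N.
Proof.
split=> [[k ->]|->]; first by rewrite big_ord0.
by exists (fun=> 0%N); rewrite big_ord0.
Qed.

Lemma nspan_cons (g : nat) (s : seq nat) (n : nat) :
  nspan (g :: s) n <-> exists x m : nat, nspan s m /\ n = (x * g + m)%N.
Proof.
split=> [[k ->]|[x [m [[k ->] ->]]]].
  exists (k 0%N), (\sum_(i < size s) k i.+1 * nth 0 s i)%N.
  by split; [exists (k \o succn) | rewrite big_ord_recl].
exists (fun i => if i is j.+1 then k j else x).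
by rewrite big_ord_recl.
Qed.

Lemma nspan3P (g1 g2 g3 n : nat) :
  nspan [:: g1; g2; g3] n <->
  exists x y z : nat, n = (x * g1 + y * g2 + z * g3)%N.
Proof.
split.
  move=> /nspan_cons[x [_ [/nspan_cons[y [_ [/nspan_cons[z [_ [/nspan_nil-> ->]]] ->]]] ->]]].
  by exists x, y, z; lia.
move=> [x [y [z ->]]].
apply/nspan_cons; exists x, (y * g2 + z * g3)%N; split; last by lia.
apply/nspan_cons; exists y, (z * g3)%N; split=> //.
by apply/nspan_cons; exists z, 0%N; split; [apply/nspan_nil | lia].
Qed.

Lemma nspan4P (g1 g2 g3 g4 n : nat) :
  nspan [:: g1; g2; g3; g4] n <->
  exists x y z t : nat, n = (x * g1 + y * g2 + z * g3 + t * g4)%N.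
Proof.
split.
  move=> /nspan_cons[x [_ [/nspan3P[y [z [t ->]]] ->]]].
  by exists x, y, z, t; lia.
move=> [x [y [z [t ->]]]].
apply/nspan_cons; exists x, (y * g2 + z * g3 + t * g4)%N; split; last by lia.
by apply/nspan3P; exists y, z, t.
Qed.

Lemma sum_inverses_mod (a b c gamma beta alpha : nat) :
  coprime a b -> coprime a c -> coprime b c ->
  (gamma * (a * b) = 1 %[mod c])%N ->
  (beta * (a * c) = 1 %[mod b])%N ->
  (alpha * (b * c) = 1 %[mod a])%N ->
  (gamma * (a * b) + beta * (a * c) + alpha * (b * c) = 1 %[mod a * b * c])%N.
Proof.
move=> cab cac cbc gP bP aP; apply/eqP.
rewrite chinese_remainder ?coprimeMl ?cac ?cbc // chinese_remainder //.
apply/andP; split; first (apply/andP; split); apply/eqP.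
- rewrite -[RHS]aP -[in LHS]modnDml.
  suff -> : ((gamma * (a * b) + beta * (a * c)) %% a = 0)%N by [].
  by rewrite (_ : _ + _ = (gamma * b + beta * c) * a)%N ?modnMl //; lia.
- rewrite -[RHS]bP -addnA addnC -addnA -[in LHS]modnDmr.
  suff -> : ((alpha * (b * c) + gamma * (a * b)) %% b = 0)%N by rewrite addn0.
  by rewrite (_ : _ + _ = (alpha * c + gamma * a) * b)%N ?modnMl //; lia.
- rewrite -[RHS]gP -addnA -[in LHS]modnDmr.
  suff -> : ((beta * (a * c) + alpha * (b * c)) %% c = 0)%N by rewrite addn0.
  by rewrite (_ : _ + _ = (beta * a + alpha * b) * c)%N ?modnMl //; lia.
Qed.

Arguments sum_inverses_mod {a b c gamma beta alpha}.

(** Only the quotient by [abc] is left to find.  Every summand is below [abc],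
    so it is at most 2; it is not 0 because the sum exceeds 1, and quotient 1
    would exhibit [abc + 1] as a combination of [ab], [ac], [bc]. *)
Lemma sum_inverses_eq (a b c gamma beta alpha : nat) :
  (1 < a)%N -> (1 < b)%N -> (1 < c)%N ->
  (0 < gamma < c)%N -> (0 < beta < b)%N -> (0 < alpha < a)%N ->
  (gamma * (a * b) + beta * (a * c) + alpha * (b * c) = 1 %[mod a * b * c])%N ->
  ~ nspan [:: a * b; a * c; b * c]%N (a * b * c + 1)%N ->
  (gamma * (a * b) + beta * (a * c) + alpha * (b * c) = 2 * (a * b * c) + 1)%N.
Proof.
move=> a1 b1 c1 /andP[g0 gc] /andP[b0 bb] /andP[al0 ala] sumP hS.
set s := (_ + _ + _)%N in sumP *; set N := (a * b * c)%N in sumP hS *.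
have N1 : (1 < N)%N by rewrite /N; nia.
have s1 : (1 < s)%N by rewrite /s; nia.
have sN : (s < 3 * N)%N.
  have h1 : (gamma * (a * b) < N)%N by rewrite /N mulnC ltn_pmul2l; nia.
  have h2 : (beta * (a * c) < N)%N.
    by rewrite /N (_ : a * b * c = b * (a * c))%N ?ltn_pmul2r; nia.
  have h3 : (alpha * (b * c) < N)%N by rewrite /N -mulnA ltn_pmul2r; nia.
  by rewrite /s; lia.
have sE := divn_eq s N; rewrite sumP (modn_small N1) in sE.
have q1 : (s %/ N != 1)%N.
  apply/eqP=> q1; apply: hS; apply/nspan3P; exists gamma, beta, alpha.
  by rewrite -/s sE q1 mul1n.
move: (s %/ N)%N sE q1 => [|[|[|q]]] sE // _; by [lia | nia].
Qed.

(** Two representations of one integer differ by a relation among [ab], [ac],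
    [bc].  Reading it modulo [c] and modulo [b] shows that the first two
    coordinates move by multiples of [c] and of [b]; these multiples are
    nonnegative when one of the representations is reduced and the other has
    nonnegative coordinates there.  This gives both the uniqueness of normal
    forms and the monotonicity of the last coordinate under reduction. *)
Lemma cone_reduction (a b c x y X Y : nat) (z Z : int) :
  coprime a b -> coprime a c -> coprime b c ->
  (x < c)%N -> (y < b)%N ->
  x%:Z * (a%:Z * b%:Z) + y%:Z * (a%:Z * c%:Z) + z * (b%:Z * c%:Z) =
  X%:Z * (a%:Z * b%:Z) + Y%:Z * (a%:Z * c%:Z) + Z * (b%:Z * c%:Z) ->
  exists p q : nat,
    [/\ X = (x + p * c)%N, Y = (y + q * b)%N & z = Z + (p%:Z + q%:Z) * a%:Z].
Proof.
move=> cab cac cbc xc yb e.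
have [p Xp] : exists p : int, X%:Z - x%:Z = p * c%:Z.
  (* [a * b] is invertible modulo [c], and the other terms are divisible
     by [c]. *)
  apply/dvdzP; rewrite -(@Gauss_dvdzl _ _ (a%:Z * b%:Z)); last first.
    by rewrite -PoszM coprimezE /= coprimeMr coprime_sym cac coprime_sym.
  by apply/dvdzP; exists ((y%:Z - Y%:Z) * a%:Z + (z - Z) * b%:Z); lia.
have [q Yq] : exists q : int, Y%:Z - y%:Z = q * b%:Z.
  apply/dvdzP; rewrite -(@Gauss_dvdzl _ _ (a%:Z * c%:Z)); last first.
    by rewrite -PoszM coprimezE /= coprimeMr coprime_sym cab.
  by apply/dvdzP; exists ((x%:Z - X%:Z) * a%:Z + (z - Z) * c%:Z); lia.
have p0 : 0 <= p by nia.
have q0 : 0 <= q by nia.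
exists `|p|%N, `|q|%N; split; try nia.
have bc0 : b%:Z * c%:Z != 0 by nia.
apply: (mulIf bc0); rewrite !gez0_abs //.
have -> : z * (b%:Z * c%:Z) = (X%:Z - x%:Z) * (a%:Z * b%:Z)
    + (Y%:Z - y%:Z) * (a%:Z * c%:Z) + Z * (b%:Z * c%:Z) by lia.
by rewrite Xp Yq; ring.
Qed.

Arguments cone_reduction {a b c x y X Y z Z}.

(** The identity assumed here is a Bezout relation for [ab], [ac], [bc]: multiplying
    it by [n] represents [n], and dividing the first two coefficients by [c] and
    [b] moves the quotients, times [abc], to the last coordinate. *)
Lemma normal_form (a b c gamma beta alpha n : nat) :
  (0 < b)%N -> (0 < c)%N ->
  (gamma * (a * b) + beta * (a * c) + alpha * (b * c) = 2 * (a * b * c) + 1)%N ->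
  exists (x y : nat) (z : int), [/\ (x < c)%N, (y < b)%N &
    n%:Z = x%:Z * (a%:Z * b%:Z) + y%:Z * (a%:Z * c%:Z) + z * (b%:Z * c%:Z)].
Proof.
move=> b0 c0 sumE.
exists (n * gamma %% c)%N, (n * beta %% b)%N,
  (n%:Z * alpha%:Z - 2 * n%:Z * a%:Z
   + ((n * gamma %/ c)%N%:Z + (n * beta %/ b)%N%:Z) * a%:Z).
rewrite !ltn_mod; split=> //.
have gE := divn_eq (n * gamma) c; have bE := divn_eq (n * beta) b.
move: (_ %/ c)%N (_ %% c)%N (_ %/ b)%N (_ %% b)%N gE bE => q x q' y gE bE.
have {}gE : n%:Z * gamma%:Z = q%:Z * c%:Z + x%:Z by lia.
have {}bE : n%:Z * beta%:Z = q'%:Z * b%:Z + y%:Z by lia.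
have {}sumE : 1 = gamma%:Z * (a%:Z * b%:Z) + beta%:Z * (a%:Z * c%:Z)
    + alpha%:Z * (b%:Z * c%:Z) - 2 * (a%:Z * b%:Z * c%:Z) by lia.
rewrite -[LHS]mulr1 {1}sumE.
transitivity (n%:Z * gamma%:Z * (a%:Z * b%:Z) + n%:Z * beta%:Z * (a%:Z * c%:Z)
  + n%:Z * alpha%:Z * (b%:Z * c%:Z) - 2 * n%:Z * (a%:Z * b%:Z * c%:Z)).
  by ring.
by rewrite gE bE; ring.
Qed.

Arguments normal_form {a b c gamma beta alpha}.

(** Each disjunct provides a representation, the first without the generator
    [abc + 1] and the second with one copy of it.  When [z < 0], any
    representation needs exactly one copy, and then uniqueness of normal forms
    forces the second disjunct. *)
Lemma mem_extended (a b c gamma beta alpha x y n : nat) (z : int) :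
  (0 < a)%N -> (0 < b)%N -> (0 < c)%N ->
  coprime a b -> coprime a c -> coprime b c ->
  (gamma * (a * b) + beta * (a * c) + alpha * (b * c) = 2 * (a * b * c) + 1)%N ->
  (0 < alpha)%N -> (x < c)%N -> (y < b)%N ->
  n%:Z = x%:Z * (a%:Z * b%:Z) + y%:Z * (a%:Z * c%:Z) + z * (b%:Z * c%:Z) ->
  nspan [:: a * b; a * c; b * c; a * b * c + 1]%N n <->
  (0 <= z) || [&& gamma <= x, beta <= y & (alpha%:Z - a%:Z <= z)%R]%N.
Proof.
move=> a0 b0 c0 cab cac cbc sumE al0 xc yb nE.
have wE : a%:Z * b%:Z * c%:Z + 1 = gamma%:Z * (a%:Z * b%:Z)
    + beta%:Z * (a%:Z * c%:Z) + (alpha%:Z - a%:Z) * (b%:Z * c%:Z) by lia.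
split=> [/nspan4P[x' [y' [z' [t nE']]]]|]; last first.
  move=> /orP[z0|/and3P[lex ley az]]; apply/nspan4P.
    by exists x, y, `|z|%N, 0%N; nia.
  exists (x - gamma)%N, (y - beta)%N, `|(z - (alpha%:Z - a%:Z))%R|%N, 1%N.
  apply/eqP; rewrite -eqz_nat nE !(PoszD, PoszM) -!subzn // gez0_abs; last by lia.
  by rewrite wE; apply/eqP; ring.
case: (leP 0 z) => [//|zneg] /=.
have {}nE' : n%:Z = x'%:Z * (a%:Z * b%:Z) + y'%:Z * (a%:Z * c%:Z)
   + z'%:Z * (b%:Z * c%:Z) + t%:Z * (a%:Z * b%:Z * c%:Z + 1) by lia.
case: t nE' => [|[|t]] nE'.
- have e := etrans (esym nE) nE'; rewrite mul0r addr0 in e.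
  have [p [q [_ _ zE]]] := cone_reduction cab cac cbc xc yb e.
  by nia.
- have e : x%:Z * (a%:Z * b%:Z) + y%:Z * (a%:Z * c%:Z) + z * (b%:Z * c%:Z) =
      (x' + gamma)%N%:Z * (a%:Z * b%:Z) + (y' + beta)%N%:Z * (a%:Z * c%:Z)
      + (z'%:Z + (alpha%:Z - a%:Z)) * (b%:Z * c%:Z).
    by rewrite -nE nE' mul1r wE !PoszD; ring.
  have [p [q [xE yE zE]]] := cone_reduction cab cac cbc xc yb e.
  (* A borrow would add at least [a] to [z], making it at least [alpha > 0]. *)
  have pq0 : (p + q = 0)%N.
    have [//|pq] := posnP (p + q); have : 1 * a%:Z <= (p%:Z + q%:Z) * a%:Z.
      by rewrite ler_wpM2r //; lia.
    by lia.
  have [p0 q0] : p = 0%N /\ q = 0%N by lia.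
  by rewrite p0 q0 in xE yE zE; lia.
(* [n] is below [2abc], since [x < c], [y < b] and [z < 0]. *)
- exfalso.
  have h1 : x%:Z * (a%:Z * b%:Z) <= c%:Z * (a%:Z * b%:Z) by rewrite ler_wpM2r //; lia.
  have h2 : y%:Z * (a%:Z * c%:Z) <= b%:Z * (a%:Z * c%:Z) by rewrite ler_wpM2r //; lia.
  have h3 : z * (b%:Z * c%:Z) <= 0 by rewrite mulr_le0_ge0 //; lia.
  have h4 : 2 * (a%:Z * b%:Z * c%:Z + 1) <= t.+2%:Z * (a%:Z * b%:Z * c%:Z + 1).
    by rewrite ler_wpM2r //; lia.
  have h5 : 0 <= x'%:Z * (a%:Z * b%:Z) by [].
  have h6 : 0 <= y'%:Z * (a%:Z * c%:Z) by [].
  have h7 : 0 <= z'%:Z * (b%:Z * c%:Z) by [].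
  by lia.
Qed.

(** This makes the maximum a natural number. *)
Lemma first_candidate_ge0 (a b c gamma : nat) :
  (1 < a)%N -> (1 < b)%N -> (0 < gamma)%N ->
  0 <= (gamma%:Z - 1) * (a%:Z * b%:Z) + (b%:Z - 1) * (a%:Z * c%:Z)
       - b%:Z * c%:Z.
Proof.
move=> a1 b1 g0.
have -> : (gamma%:Z - 1) * (a%:Z * b%:Z) + (b%:Z - 1) * (a%:Z * c%:Z)
    - b%:Z * c%:Z = (gamma%:Z - 1) * (a%:Z * b%:Z)
    + ((a%:Z - 1) * (b%:Z - 1) - 1) * c%:Z by ring.
by rewrite addr_ge0 // mulr_ge0 //; nia.
Qed.

Lemma max3_cases (u v w : int) :
  let m := Num.max u (Num.max v w) in [\/ m = u, m = v | m = w].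
Proof.
rewrite /= /Num.max; case: ifP => _; last exact: Or31.
by case: ifP => _; [apply: Or33 | apply: Or32].
Qed.

Theorem proposition3p17 (a b c gamma beta alpha : nat)
  (ha : (2 <= a)%N) (hab : (a < b)%N) (hbc : (b < c)%N)
  (cop_ab : coprime a b) (cop_ac : coprime a c) (cop_bc : coprime b c)
  (hS : ~ nspan [:: a * b; a * c; b * c]%N (a * b * c + 1)%N)
  (hgamma : (1 <= gamma <= c - 1)%N)
  (gammaP : (gamma * (a * b) = 1 %[mod c])%N)
  (hbeta : (1 <= beta <= b - 1)%N)
  (betaP : (beta * (a * c) = 1 %[mod b])%N)
  (halpha : (1 <= alpha <= a - 1)%N)
  (alphaP : (alpha * (b * c) = 1 %[mod a])%N) :
  exists2 F : nat,
    is_frobenius (nspan [:: a * b; a * c; b * c; a * b * c + 1]%N) F &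
    F%:Z =
      Num.max
        ((gamma%:Z - 1) * (a%:Z * b%:Z) + (b%:Z - 1) * (a%:Z * c%:Z)
           - b%:Z * c%:Z)
        (Num.max
          ((c%:Z - 1) * (a%:Z * b%:Z) + (beta%:Z - 1) * (a%:Z * c%:Z)
             - b%:Z * c%:Z)
          ((c%:Z - 1) * (a%:Z * b%:Z) + (b%:Z - 1) * (a%:Z * c%:Z)
             + (alpha%:Z - a%:Z - 1) * (b%:Z * c%:Z))).
Proof.
have sumP := sum_inverses_mod cop_ab cop_ac cop_bc gammaP betaP alphaP.
clear gammaP betaP alphaP.
have a0 : (0 < a)%N := ltnW ha.
have b0 : (0 < b)%N := leq_ltn_trans (leq0n a) hab.
have c0 : (0 < c)%N := leq_ltn_trans (leq0n b) hbc.
have sumE : (gamma * (a * b) + beta * (a * c) + alpha * (b * c)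
             = 2 * (a * b * c) + 1)%N.
  by apply: sum_inverses_eq sumP hS; lia.
clear hS sumP.
have memP x y n z := @mem_extended a b c gamma beta alpha x y n z
  a0 b0 c0 cop_ab cop_ac cop_bc sumE ltac:(lia).
have repr n := normal_form n b0 c0 sumE.
clear sumE.
set M := Num.max _ _.
have M0 : 0 <= M.
  by rewrite /M le_max first_candidate_ge0 ?(ltn_trans ha hab) //; case/andP: hgamma.
exists `|M|%N; last by rewrite gez0_abs.
have ME : `|M|%N%:Z = M by rewrite gez0_abs.
split=> [|n nS'].
  have cE m : (0 < m)%N -> m%:Z - 1 = (m - 1)%N%:Z by move=> m0; rewrite subzn.
  (* Each corner is a normal form that fails the criterion. *)
  have missed x y z : (x < c)%N -> (y < b)%N ->
      ~ ((0 <= z) || [&& gamma <= x, beta <= y & (alpha%:Z - a%:Z <= z)%R]%N) ->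
      M = x%:Z * (a%:Z * b%:Z) + y%:Z * (a%:Z * c%:Z) + z * (b%:Z * c%:Z) ->
      ~ nspan [:: a * b; a * c; b * c; a * b * c + 1]%N `|M|%N.
    by move=> xc yb out; rewrite -ME => nE /(memP _ _ _ _ xc yb nE).
  case/andP: (hgamma) => g0 _; case/andP: (hbeta) => be0 _.
  have [] := max3_cases _ _ _ : [\/ M = _, M = _ | M = _]; rewrite !cE //.
  - by rewrite -(mulN1r (b%:Z * c%:Z)); apply: missed; lia.
  - by rewrite -(mulN1r (b%:Z * c%:Z)); apply: missed; lia.
  - by apply: missed; lia.
rewrite -lez_nat ME.
have [x [y [z [xc yb nE]]]] := repr n.
have {nS'} gap : ~ ((0 <= z) || [&& gamma <= x, beta <= y & (alpha%:Z - a%:Z <= z)%R]%N).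
  by move=> h; apply: nS'; apply/(memP _ _ _ _ xc yb nE).
have z0 : z <= -1 by lia.
(* A gap violates one of three inequalities; each violation bounds [n] by the
   corresponding corner. *)
have bound x1 y1 (z1 : int) : x%:Z <= x1 -> y%:Z <= y1 -> z <= z1 ->
    n%:Z <= x1 * (a%:Z * b%:Z) + y1 * (a%:Z * c%:Z) + z1 * (b%:Z * c%:Z).
  by move=> hx hy hz; rewrite nE !lerD // ler_wpM2r.
rewrite /M !le_max -!(mulN1r (b%:Z * c%:Z)).
have [lex|ltx] := leqP gamma x; last by rewrite bound //; lia.
have [ley|lty] := leqP beta y; last by rewrite [X in _ || (X || _)]bound ?orbT //; lia.
by rewrite [X in _ || (_ || X)]bound ?orbT //; lia.
Qed.
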